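(* Let $X$ be a finite CW complex with oriented cells, $d\ge1$, and $b_{d-1}=\operatorname{rank}B_{d-1}(X;\mathbb Z)$. For $0<k\le b_{d-1}$, the $k$-th elementary symmetric function of the eigenvalues of the combinatorial Laplacian (Kirchhoff map) $\partial_d\cdot\partial_d^\star:C_{d-1}(X;\mathbb R)\to C_{d-1}(X;\mathbb R)$ equals $$\sum_{V\ \text{a forest of size } k}\ \ \left[\ \sum_{W\ \text{a spanning coforest of } X_V}\big|H_{d-1}(X_V,X_{W^c};\mathbb Z)\big|^2\ \right],$$ where each group $H_{d-1}(X_V,X_{W^c};\mathbb Z)$ occurring is finite.
   Context: $C_i$, $Z_i$, $B_i$ are cellular chains, cycles, boundaries; $S_i$ is the set of oriented $i$-cells; $X^{(i)}$ is the $i$-skeleton ($X^{(-1)}=\emptyset$). $\partial_d:C_d(X;\mathbb R)\to C_{d-1}(X;\mathbb R)$ is the cellular boundary and $\partial_d^\star$ is its adjoint for the inner products in which the cells are orthonormal. A forest of size $k$ ($d$-dimensional) is a set $V\subset S_d$ with $|V|=k$ such that $X_V=X^{(d-1)}\cup V$ satisfies $Z_d(X_V;\mathbb Z)=0$. A ($(d-1)$-dimensional) spanning coforest of $X_V$ is a set $W\subset S_{d-1}$ such that restricting chains to the cells of $W$ gives an isomorphism from $B_{d-1}(X_V;\mathbb Q)$ to the $\mathbb Q$-vector space $C_{d-1}(X^{(d-2)}\cup W;\mathbb Q)$ with basis $W$. Here $X_{W^c}=X^{(d-2)}\cup(S_{d-1}\setminus W)$, a subcomplex of $X_V$. *)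

(* Defs.v *)
From HB Require Import structures.
From mathcomp Require Import all_boot all_order all_algebra.
From mathcomp Require Import all_classical all_reals all_analysis.
From mathcomp Require Import freeg.
From mathcomp Require mpoly.

Set Implicit Arguments.
Unset Strict Implicit.
Unset Printing Implicit Defensive.

Import Order.TTheory GRing.Theory Num.Theory.
Import numFieldNormedType.Exports.

Local Open Scope classical_set_scope.
Local Open Scope ring_scope.

Section SingularChains.
Variable R : realType.

Definition std_simplex (n : nat) : set 'rV[R]_n.+1 :=
  [set x | (forall i, 0 <= x ord0 i) /\ \sum_i x ord0 i = 1].

Arguments std_simplex : clear implicits.

(* [set_type] carries the subspace topology *)
Definition simplex (n : nat) := set_type (std_simplex n).

Definition simplex_interior (n : nat) : set (simplex n) :=
  [set x : simplex n | forall i, 0 < (set_val x : 'rV[R]_n.+1) ord0 i].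

Arguments simplex_interior : clear implicits.

Definition face_vec (n : nat) (i : 'I_n.+2) (x : 'rV[R]_n.+1) : 'rV[R]_n.+2 :=
  \row_j (if unlift i j is Some j' then x ord0 j' else 0).

Lemma face_vec_subproof (n : nat) (i : 'I_n.+2) (x : simplex n) :
  face_vec i (set_val x) \in std_simplex n.+1.
Proof.
have /set_mem [x0 x1] := valP x; apply/mem_set; split=> [j|].
  by rewrite mxE; case: unliftP => //= j' _; exact: x0.
rewrite (bigD1_ord i) //= mxE unlift_none add0r -[RHS]x1.
by apply: eq_bigr => j _; rewrite mxE liftK.
Qed.

Definition face (n : nat) (i : 'I_n.+2) (x : simplex n) : simplex n.+1 :=
  exist (fun y => y \in std_simplex n.+1) _ (face_vec_subproof i x).

Variable X : topologicalType.

(* Integral singular n-chains.  Continuity of the maps involved is not part of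
   the type, it is required in [sing_chain_in]. *)
Definition sing_chain (n : nat) := {freeg (simplex n -> X)}.

Definition sing_gen (n : nat) (f : simplex n -> X) : sing_chain n :=
  Freeg [:: (1 : int, f)].

Definition sing_chain_in (A : set X) (n : nat) : set (sing_chain n) :=
  [set c | forall f, f \in dom c -> continuous f /\ range f `<=` A].

Definition sing_bd_gen (n : nat) (f : simplex n.+1 -> X) : sing_chain n :=
  \sum_(i < n.+2) (sing_gen (f \o face i)) *~ ((-1) ^+ i).

Definition sing_bd (n : nat) (c : sing_chain n.+1) : sing_chain n :=
  \sum_(f <- dom c) (sing_bd_gen f) *~ (coeff f c).

(* The classes of the chains b and b' in H_n(A, A') are the same. *)
Definition sing_homologous (A A' : set X) (n : nat) (b b' : sing_chain n) :=
  exists (c : sing_chain n.+1) (a : sing_chain n),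
    [/\ sing_chain_in A c, sing_chain_in A' a & b - b' = sing_bd c + a].

End SingularChains.

Arguments std_simplex R n : clear implicits.
Arguments simplex_interior R n : clear implicits.

Definition cells_of_dim (I : Type) (dim : I -> nat) (n : nat) :=
  {s : I | dim s == n}.

Definition cell_in_dim (I : Type) (dim : I -> nat) (s : I) :
  cells_of_dim dim (dim s) := exist _ s (eqxx (dim s)).

(* A finite CW complex with oriented cells.  The model of the closed n-ball is
   the standard n-simplex, so that a characteristic map is a singular simplex,
   and the orientation of an n-cell is the class of this singular simplex in
   H_n(X^(n), X^(n-1)); reversing an orientation amounts to composing the
   characteristic map with a transposition of the vertices (0-cells have their
   canonical orientation).  As there are finitely many cells and the space is
   Hausdorff, the closure-finiteness and weak topology axioms are automatic.

   [cw_inc s t] is the incidence number of an (n+1)-cell s and an n-cell t: the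
   classes of the n-cells form a basis of H_n(X^(n), X^(n-1)), and [cw_incP]
   says that the [cw_inc s t] are the coordinates in this basis of the image of
   the class of s under the connecting homomorphism
     H_(n+1)(X^(n+1), X^(n)) -> H_n(X^(n), X^(n-1)).
   Its values at other pairs of cells are irrelevant. *)
Record finite_cw (R : realType) := FiniteCW {
  cw_space :> topologicalType;
  cw_cell : finType;
  cw_dim : cw_cell -> nat;
  cw_char : forall n, cells_of_dim cw_dim n -> simplex R n -> cw_space;
  cw_open_cell := fun s : cw_cell =>
    cw_char (cell_in_dim cw_dim s) @` simplex_interior R (cw_dim s);
  (* X^(n-1) as a subspace *)
  cw_below := fun n : nat =>
    \bigcup_(s in [set s | (cw_dim s < n)%N]) cw_open_cell s;
  cw_hausdorff : hausdorff_space cw_space;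
  cw_char_continuous : forall n (s : cells_of_dim cw_dim n),
    continuous (cw_char s);
  cw_char_inj : forall n (s : cells_of_dim cw_dim n),
    set_inj (simplex_interior R n) (cw_char s);
  cw_partition : forall x : cw_space, exists! s, cw_open_cell s x;
  cw_char_boundary : forall n (s : cells_of_dim cw_dim n),
    cw_char s @` (~` simplex_interior R n) `<=` cw_below n;
  cw_inc : cw_cell -> cw_cell -> int;
  cw_incP : forall n (s : cells_of_dim cw_dim n.+1),
    sing_homologous (cw_below n.+1) (cw_below n)
      (sing_bd_gen (cw_char s))
      (\sum_(t : cells_of_dim cw_dim n)
         (sing_gen (cw_char t)) *~ (cw_inc (\val s) (\val t)))
}.

Section CellularHomology.
Variables (R : realType) (X : finite_cw R).

Definition cells (i : nat) : {set cw_cell X} := [set s | cw_dim s == i]%SET.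

(* the cells of X^(i-1) *)
Definition cells_below (i : nat) : {set cw_cell X} :=
  [set s | (cw_dim s < i)%N]%SET.

(* Subcomplexes Y are given by their sets of cells.  The chain group C_i(X; A)
   is identified with the column vectors indexed by the i-cells. *)

(* For i = 0 the target is 0; here it is encoded by the zero matrix. *)
Definition bd (A : pzRingType) (i : nat) : 'M[A]_(#|cells i.-1|, #|cells i|) :=
  \matrix_(t, s) (if (cw_dim (enum_val t)).+1 == i
                  then (cw_inc (enum_val s) (enum_val t))%:~R else 0).
Arguments bd : clear implicits.

Definition chains (A : pzRingType) (i : nat) (Y : {set cw_cell X}) :
    set 'cV[A]_#|cells i| :=
  [set c | forall s, enum_val s \notin Y -> c s ord0 = 0].
Arguments chains : clear implicits.

Definition cycles (A : pzRingType) (i : nat) (Y : {set cw_cell X}) :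
    set 'cV[A]_#|cells i| :=
  [set c | chains A i Y c /\ bd A i *m c = 0].
Arguments cycles : clear implicits.

Definition boundaries (A : pzRingType) (i : nat) (Y : {set cw_cell X}) :
    set 'cV[A]_#|cells i| :=
  [set bd A i.+1 *m c | c in chains A i.+1 Y].
Arguments boundaries : clear implicits.

Definition rel_cycles (A : pzRingType) (i : nat) (Y Y' : {set cw_cell X}) :
    set 'cV[A]_#|cells i| :=
  [set c | chains A i Y c /\ chains A i.-1 Y' (bd A i *m c)].
Arguments rel_cycles : clear implicits.

Definition rel_boundaries (A : pzRingType) (i : nat) (Y Y' : {set cw_cell X}) :
    set 'cV[A]_#|cells i| :=
  [set b + a | b in boundaries A i Y & a in chains A i Y'].
Arguments rel_boundaries : clear implicits.

(* H_i(Y, Y'; A), as the set of cosets of the relative boundaries *)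
Definition rel_homology (A : pzRingType) (i : nat)
    (Y Y' : {set cw_cell X}) : set (set 'cV[A]_#|cells i|) :=
  [set [set z | rel_boundaries A i Y Y' (z - c)] | c in rel_cycles A i Y Y'].
Arguments rel_homology : clear implicits.

Definition restrict_chain (A : pzRingType) (i : nat) (W : {set cw_cell X})
    (c : 'cV[A]_#|cells i|) : 'cV[A]_#|cells i| :=
  \col_s (if enum_val s \in W then c s ord0 else 0).
Arguments restrict_chain : clear implicits.

Lemma restrict_chain_linear (A : pzRingType) (i : nat) (W : {set cw_cell X}) :
  linear (restrict_chain A i W).
Proof.
move=> a u v; apply/matrixP=> s t; rewrite !mxE.
by case: ifP; rewrite ?mulr0 ?addr0 // !mxE.
Qed.

Definition is_forest (d : nat) (V : {set cw_cell X}) : Prop :=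
  V \subset cells d /\ cycles int d (cells_below d :|: V) = [set 0].

(* V is a set of d-cells, W a set of (d-1)-cells; the restriction map is
   linear ([restrict_chain_linear]), so it is an isomorphism when it is bijective. *)
Definition is_spanning_coforest (d : nat) (V W : {set cw_cell X}) : Prop :=
  W \subset cells d.-1 /\
  set_bij (boundaries rat d.-1 (cells_below d :|: V))
          (chains rat d.-1 (cells_below d.-1 :|: W))
          (restrict_chain rat d.-1 W).

(* H_(d-1)(X_V, X_(W^c); Z) *)
Definition forest_homology (d : nat) (V W : {set cw_cell X}) :=
  rel_homology int d.-1
    (cells_below d :|: V) (cells_below d.-1 :|: (cells d.-1 :\: W)).

(* The cells are orthonormal, so the adjoint of bd is its transpose. *)
Definition laplacian (d : nat) : 'M[R]_#|cells d.-1| :=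
  bd R d *m (bd R d)^T.

Lemma bd_adjoint (d : nat) (x : 'cV[R]_#|cells d|)
    (y : 'cV[R]_#|cells d.-1|) :
  (bd R d *m x)^T *m y = x^T *m ((bd R d)^T *m y).
Proof. by rewrite trmx_mul mulmxA. Qed.

End CellularHomology.

Arguments cells {R} X i.
Arguments bd {R} X A i.
Arguments chains {R X} A i Y _.
Arguments cycles {R X} A i Y _.
Arguments boundaries {R X} A i Y _.
Arguments rel_cycles {R X} A i Y Y' _.
Arguments rel_boundaries {R X} A i Y Y' _.
Arguments rel_homology {R X} A i Y Y' _.
Arguments restrict_chain {R X} A i W c.
Arguments is_forest {R X} d V.
Arguments is_spanning_coforest {R X} d V W.
Arguments forest_homology {R X} d V W _.
Arguments laplacian {R} X d.

Definition z_independent (M : zmodType) (r : nat) (v : 'I_r -> M) : Prop :=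
  forall a : 'I_r -> int, \sum_i v i *~ a i = 0 -> forall i, a i = 0.

(* r is the rank of the subgroup B of M *)
Definition is_group_rank (M : zmodType) (B : set M) (r : nat) : Prop :=
  (exists v : 'I_r -> M, (forall i, B (v i)) /\ z_independent v) /\
  (forall m (v : 'I_m -> M),
     (forall i, B (v i)) -> z_independent v -> (m <= r)%N).

(* the eigenvalues of A, with multiplicities *)
Definition is_spectrum (F : comNzRingType) (n : nat) (A : 'M[F]_n)
    (s : 'I_n -> F) : Prop :=
  char_poly A = \prod_(i < n) ('X - (s i)%:P).

Definition elem_sym (F : comNzRingType) (n k : nat) (s : 'I_n -> F) : F :=
  mpoly.meval s (mpoly.mesym n F k).

(* Main.v *)
(* Let M be the integral matrix of the boundary map from d-chains to
   (d-1)-chains.  A set V of k d-cells is a forest with spanning coforest W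
   exactly when |W| = k and the submatrix M_(W,V) is nonsingular.  In that case
   H_(d-1)(X_V, X_(W^c); Z) = Z^W / M_(W,V) Z^V, which has |det M_(W,V)|
   elements.  By Cauchy-Binet, the sum of the det(M_(W,V))^2 is the sum of the
   principal k-minors of the Laplacian M M^T; as the sum of the principal
   k-minors of a product PQ is the same as for QP, it is invariant under
   conjugation, and diagonalizing the Laplacian identifies it with the k-th
   elementary symmetric function of the eigenvalues. *)

Require Import Defs.
From mathcomp Require Import all_boot all_order all_algebra finmap perm.
From mathcomp Require Import all_classical all_reals all_analysis.
From mathcomp Require Import complex.

Set Implicit Arguments.
Unset Strict Implicit.
Unset Printing Implicit Defensive.

Import Order.TTheory GRing.Theory Num.Theory.

Local Open Scope classical_set_scope.
Local Open Scope ring_scope.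

(** * Principal minors *)

(* The sum runs over all maps instead of over k-subsets: each subset is counted
   k! times, and the maps that are not injective contribute 0. *)
Lemma Cauchy_Binet_ffun (R : comNzRingType) (k n : nat)
    (A : 'M[R]_(k, n)) (B : 'M[R]_(n, k)) :
  \sum_(g : {ffun 'I_k -> 'I_n}) \det (colsub g A) * \det (rowsub g B) =
  k`!%:R * \det (A *m B).
Proof.
have -> : \det (A *m B) =
    \sum_(g : {ffun 'I_k -> 'I_n}) (\prod_i A i (g i)) * \det (rowsub g B).
  transitivity (\sum_(s : 'S_k) \sum_(g : {ffun 'I_k -> 'I_n})
      (-1) ^+ s * \prod_i (A i (g i) * B (g i) (s i))).
    apply: eq_bigr => s _; rewrite -mulr_sumr; congr (_ * _).
    rewrite -(bigA_distr_bigA (fun i j => A i j * B j (s i))) /=.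
    by apply: eq_bigr => i _; rewrite mxE.
  rewrite exchange_big; apply: eq_bigr => g _; rewrite mulr_sumr.
  apply: eq_bigr => s _; rewrite big_split mulrCA /=.
  by do 2!congr (_ * _); apply: eq_bigr => i _; rewrite !mxE.
(* Expand only the first determinant; each permutation [s] then contributes one copy of
   [\det (A *m B)], whence the factor [k!]. *)
transitivity (\sum_(s : 'S_k) \sum_(g : {ffun 'I_k -> 'I_n})
    (-1) ^+ s * \prod_i A i (g (s i)) * \det (rowsub g B)).
  rewrite exchange_big; apply: eq_bigr => g _; rewrite mulr_suml.
  apply: eq_bigr => s _; congr (_ * _ * _).
  by apply: eq_bigr => i _; rewrite mxE.
rewrite -card_Sn -[#|_|%:R]sumr_const mulr_suml; apply: eq_bigr => s _.
(* Replacing [g] by [g \o s^-1] permutes the rows of [rowsub g B], and the resulting sign cancels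
   [(-1) ^+ s]. *)
rewrite mul1r (reindex
  (fun g : {ffun 'I_k -> 'I_n} => [ffun i => g (s^-1%g i)])).
  apply: eq_bigr => g _.
  have -> : \prod_i A i ([ffun i0 => g (s^-1%g i0)] (s i)) = \prod_i A i (g i).
    by apply: eq_bigr => i _; rewrite ffunE permK.
  have -> : rowsub [ffun i => g (s^-1%g i)] B = row_perm s^-1 (rowsub g B).
    by apply/matrixP => i j; rewrite !mxE ffunE.
  rewrite row_permE det_mulmx det_perm odd_permV.
  by rewrite -mulrA mulrCA (mulrA (_ ^+ _) (_ ^+ _)) -expr2 sqrr_sign mul1r.
exists (fun g : {ffun 'I_k -> 'I_n} => [ffun i => g (s i)]) => g _;
  by apply/ffunP => i; rewrite !ffunE ?permK ?permKV.
Qed.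

(* k! times the sum of the principal k-minors *)
Definition sum_minors (R : comNzRingType) (k n : nat) (A : 'M[R]_n) : R :=
  \sum_(f : {ffun 'I_k -> 'I_n}) \det (mxsub f f A).

Lemma sum_minors_mul (R : comNzRingType) (k n m : nat)
    (P : 'M[R]_(n, m)) (Q : 'M[R]_(m, n)) :
  k`!%:R * sum_minors k (P *m Q) =
  \sum_(f : {ffun 'I_k -> 'I_n}) \sum_(g : {ffun 'I_k -> 'I_m})
     \det (mxsub f g P) * \det (mxsub g f Q).
Proof.
rewrite mulr_sumr; apply: eq_bigr => f _.
rewrite mxsub_mul -Cauchy_Binet_ffun; apply: eq_bigr => g _.
by congr (_ * _); congr (\det _); apply/matrixP => i j; rewrite !mxE.
Qed.

(** Cauchy-Binet turns both sides into the same double sum with the roles of [f] and [g] exchanged;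
    [k!] is then cancelled in characteristic zero. *)
Lemma sum_minorsC (R : numDomainType) (k n m : nat)
    (P : 'M[R]_(n, m)) (Q : 'M[R]_(m, n)) :
  sum_minors k (P *m Q) = sum_minors k (Q *m P).
Proof.
have k_neq0 : k`!%:R != 0 :> R by rewrite pnatr_eq0 -lt0n fact_gt0.
apply: (mulfI k_neq0); rewrite !sum_minors_mul exchange_big.
by apply: eq_bigr => g _; apply: eq_bigr => f _; rewrite mulrC.
Qed.

(** A [k]-subset is the image of exactly [k!] injections from ['I_k]. *)
Lemma sum_injective_imset (R : pzSemiRingType) (T : finType) (k : nat)
    (F : {set T} -> R) :
  \sum_(f : {ffun 'I_k -> T} | injectiveb f) F [set f i | i : 'I_k] =
  k`!%:R * \sum_(W : {set T} | #|W| == k) F W.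
Proof.
rewrite (partition_big (fun f : {ffun 'I_k -> T} => [set f i | i : 'I_k])
  (fun W : {set T} => #|W| == k)) => [|f /injectiveP inj_f] /=; last first.
  by rewrite card_imset // card_ord.
rewrite mulr_sumr; apply: eq_bigr => W /eqP cardW.
rewrite (eq_bigr (fun=> F W)) => [|f /andP[_ /eqP->] //].
rewrite sumr_const mulr_natl; congr (_ *+ _).
(* Injections with image [W] are the injections into [W]: an image inside [W] of the same
   cardinality is all of [W]. *)
transitivity #|[set f in ffun_on [in W] | injectiveb (aT := 'I_k) f]|.
  rewrite -sum1_card -[RHS]sum1_card; apply: eq_bigl => f; rewrite !inE andbC.
  rewrite unfold_in /=; case: injectiveP => [inj_f|]; rewrite ?andbF ?andbT //.
  rewrite eqEcard card_imset // cardW card_ord leqnn andbT.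
  apply/fintype.subsetP/ffun_onP => [sub i|sub _ /imsetP[i _ ->]];
    last exact: sub.
  by apply: sub; apply: imset_f.
by rewrite card_inj_ffuns_on cardW card_ord ffactnn.
Qed.

(** A non-injective [f] repeats a row, so its minor is 0; an injective one selects a diagonal
    submatrix. *)
Lemma sum_minors_diag (R : comNzRingType) (k n : nat) (d : 'rV[R]_n) :
  sum_minors k (diag_mx d) =
  k`!%:R * \sum_(h : {set 'I_n} | #|h| == k) \prod_(i in h) d 0 i.
Proof.
rewrite -sum_injective_imset /sum_minors [RHS]big_mkcond /=.
apply: eq_bigr => f _; case: injectiveP => [inj_f|/injectiveP]; last first.
  rewrite /injectiveb => /dinjectivePn[i _ [j /andP[]]].
  rewrite inE eq_sym => neq_ij _ eq_f.
  by apply: (determinant_alternate neq_ij) => l; rewrite !mxE eq_f.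
rewrite big_imset /= => [|? ? _ _ /inj_f //].
have -> : mxsub f f (diag_mx d) = diag_mx (\row_i d 0 (f i)).
  by apply/matrixP => i j; rewrite !mxE (inj_eq inj_f).
by rewrite det_diag; apply: eq_bigr => i _; rewrite mxE.
Qed.

Lemma map_sum_minors (R S : comNzRingType) (h : {rmorphism R -> S})
    (k n : nat) (A : 'M[R]_n) :
  sum_minors k (map_mx h A) = h (sum_minors k A).
Proof.
rewrite rmorph_sum; apply: eq_bigr => f _.
by rewrite -map_mxsub det_map_mx.
Qed.

Lemma char_poly_conj (R : comUnitRingType) (n : nat) (P D : 'M[R]_n) :
  P \in unitmx -> char_poly (invmx P *m D *m P) = char_poly D.
Proof.
move=> Punit; rewrite /char_poly.
have -> : char_poly_mx (invmx P *m D *m P) =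
    map_mx polyC (invmx P) *m char_poly_mx D *m map_mx polyC P.
  rewrite /char_poly_mx mulmxBr mulmxBl !map_mxM /=; congr (_ - _).
  by rewrite scalar_mxC -mulmxA -map_mxM mulVmx // map_mx1 mulmx1.
rewrite !det_mulmx mulrAC -det_mulmx -map_mxM mulVmx // map_mx1 det1.
by rewrite mul1r.
Qed.

(** Over [R[i]] the matrix is Hermitian, hence unitarily diagonalizable with real eigenvalues;
    injectivity of the embedding of [R] in [R[i]] brings both identities back to [R]. *)
Lemma symmetric_spectrum (R : rcfType) (n : nat) (A : 'M[R]_n) : A^T = A ->
  exists d : 'rV[R]_n, char_poly A = \prod_i ('X - (d 0 i)%:P) /\
    forall k, sum_minors k A = sum_minors k (diag_mx d).
Proof.
move=> symA; pose toC := real_complex R; pose AC := map_mx toC A.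
have /[dup] /hermitian_normalmx /orthomx_spectralP AE : AC \is hermsymmx.
  apply: realsym_hermsym.
    by apply/is_hermitianmxP; rewrite scale1r map_mx_id // /AC map_trmx symA.
  by apply/mxOverP => i j; rewrite mxE complex_real.
move=> /hermitian_spectral_diag_real /mxOverP dreal.
pose d := map_mx (@complex.Re R) (spectral_diag AC); exists d.
have dE : spectral_diag AC = map_mx toC d.
  by apply/matrixP => i j; rewrite !mxE; apply/esym/RRe_real.
have Punit := spectral_unit AC.
split=> [|k].
  apply: (map_poly_inj toC); rewrite map_char_poly -/AC AE char_poly_conj //.
  rewrite char_poly_trig ?diag_mx_is_trig // rmorph_prod /=.
  apply: eq_bigr => i _; rewrite rmorphB /= map_polyX map_polyC /=.
  by rewrite mxE eqxx dE mxE.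
(* The invariance [sum_minorsC] lets the two conjugating matrices meet and cancel. *)
apply: complexI; rewrite -!map_sum_minors -/AC AE sum_minorsC mulmxA.
rewrite (mulmxV Punit) mul1mx dE map_diag_mx.
reflexivity.
Qed.

(** * The index of an integral lattice *)

(** With the Smith normal form [N = L *m D *m R], applying the inverse of [L] turns the lattice into
    a product of ideals generated by the [d_i]. So the vectors [L *m a] with [0 <= a_i < |d_i|]
    represent each coset once, and there are [|det N|] of them because [L] and [R] have determinant
    1 or -1. *)
Lemma image_lattice_transversal (k : nat) (N : 'M[int]_k) : \det N != 0 ->
  exists s : seq 'cV[int]_k,
    [/\ uniq s, size s = `|\det N|%N,
        forall z, exists2 a, a \in s & exists y, z - a = N *m y
      & {in s &, forall a b, (exists y, a - b = N *m y) -> a = b}].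
Proof.
have [L Lunit [R Runit [d _]]] := int_Smith_normal_form N.
set D := \matrix_(i, j) _ => NE.
have DE : D = diag_mx (\row_i d`_i).
  by apply/matrixP => i j; rewrite !mxE.
pose e (i : 'I_k) := absz d`_i.
have unit1 (P : 'M[int]_k) : P \in unitmx -> `|\det P|%N = 1%N.
  by rewrite unitmxE => /orP[] /eqP ->.
have detE : `|\det N|%N = (\prod_i e i)%N.
  rewrite NE DE !det_mulmx !abszM (unit1 L) // (unit1 R) // mul1n muln1.
  rewrite det_diag (big_morph absz abszM absz1); apply: eq_bigr => i _.
  by rewrite mxE.
rewrite -absz_gt0 detE => e_gt0.
have d_neq0 (i : 'I_k) : d`_i != 0.
  rewrite -absz_gt0 lt0n; apply: contraTneq e_gt0 => ei0.
  by rewrite (bigD1 i) //= /e ei0.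
have imP (v : 'cV_k) : (exists y, v = N *m y) <->
    forall i, (d`_i %| (invmx L *m v) i ord0)%Z.
  split=> [[y ->] i|dvd].
    rewrite NE -!mulmxA mulKmx // DE mul_diag_mx mxE mxE.
    exact: dvdz_mulr.
  exists (invmx R *m \col_i ((invmx L *m v) i ord0 %/ d`_i)%Z).
  rewrite NE -!mulmxA mulKVmx //; apply: (canRL (mulKVmx Lunit)).
  apply/colP => i; rewrite DE mul_diag_mx !mxE mulrC divzK //.
  by have := dvd i; rewrite mxE.
pose rep (a : {dffun forall i, 'I_(e i)}) : 'cV[int]_k :=
  L *m \col_i (a i : nat)%:Z.
have rep_inj a b : (exists y, rep a - rep b = N *m y) -> a = b.
  move=> /imP dvd; apply/ffunP => i; apply/val_inj/eqP => /=.
  move: (dvd i); rewrite -mulmxBr mulKmx // !mxE.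
  (* The sign of the divisor is dropped first, so that residues below [e i] are their own
     remainders. *)
  rewrite dvdzE -[absz d`_i]/(absz (e i)%:Z) -dvdzE -eqz_mod_dvd !modz_nat.
  by rewrite !modn_small.
exists (codom rep); split.
- apply/injectiveP => a b eq_ab; apply: rep_inj; exists 0.
  by rewrite eq_ab subrr mulmx0.
- rewrite size_codom card_dep_ffun foldrE big_map big_enum /=.
  by apply: eq_bigr => i _; rewrite card_ord.
- move=> z; pose u := invmx L *m z.
  have lt_e i : (`|(u i ord0 %% d`_i)%Z| < e i)%N.
    by rewrite -ltz_nat gez0_abs ?modz_ge0 ?ltz_mod.
  exists (rep [ffun i => Ordinal (lt_e i)]); first exact: codom_f.
  apply/imP => i; rewrite mulmxBr mulKmx // -/u.
  rewrite [X in (_ %| X)%Z]mxE [X in _ + X]mxE [X in _ - X]mxE ffunE /=.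
  rewrite gez0_abs ?modz_ge0 //.
  by rewrite {1}(divz_eq (u i ord0) d`_i) addrK dvdz_mull.
move=> _ _ /codomP[a ->] /codomP[b ->] /rep_inj -> //.
Qed.

(** * Chains supported on the image of an indexing *)

(** A rational kernel vector times the product of its denominators is an integral kernel vector. *)
Lemma rat_kernel_trivial (m n : nat) (A : 'M[int]_(m, n)) :
  (forall y : 'cV[int]_n, A *m y = 0 -> y = 0) ->
  forall y : 'cV[rat]_n, map_mx intr A *m y = 0 -> y = 0.
Proof.
move=> kerA y Ay0; pose c := \prod_i denq (y i 0).
have c_neq0 : c != 0 by apply/prodf_neq0 => i _; apply: denq_neq0.
pose w : 'cV[int]_n := \col_i (numq (y i 0) * \prod_(j | j != i) denq (y j 0)).
have wE : map_mx intr w = c%:~R *: y.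
  apply/colP => i; rewrite !mxE /c [in RHS](bigD1 i) //= !intrM numqE.
  by rewrite [RHS]mulrC mulrA.
have : w = 0.
  apply: kerA; apply/colP => i; apply: (@intr_inj rat).
  have := map_mxM (intr : {rmorphism int -> rat}) A w.
  rewrite /= wE -scalemxAr Ay0 scaler0.
  by move=> /colP/(_ i); rewrite !mxE.
move/(congr1 (map_mx (intr : int -> rat))); rewrite wE map_mx0 => /eqP.
by rewrite scaler_eq0 intr_eq0 (negPf c_neq0) => /eqP.
Qed.

(** Injectivity gives full column rank; surjectivity gives a right inverse column by column, hence
    full row rank. *)
Lemma mulmx_bij_square (F : fieldType) (m n : nat) (A : 'M[F]_(m, n)) :
  (forall y : 'cV[F]_n, A *m y = 0 -> y = 0) ->
  (forall z : 'cV[F]_m, exists y : 'cV[F]_n, A *m y = z) -> m = n.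
Proof.
move=> inj surj.
have /eqP <- : row_free A^T.
  apply: inj_row_free => v /(congr1 trmx); rewrite trmx_mul trmxK trmx0.
  by move=> /inj /(congr1 trmx); rewrite trmxK trmx0.
rewrite mxrank_tr; apply/esym/eqP/row_freeP.
have /choice[B BE] := fun j => surj (col j 1%:M).
exists (\matrix_(i, j) B j i 0); apply/matrixP => i j.
have /colP/(_ i) := BE j; rewrite !mxE => <-.
by apply: eq_bigr => l _; rewrite mxE.
Qed.

(** For injective [g], multiplication by [colsub g 1%:M] is extension by zero along [g], and
    [rowsub g] is the restriction inverse to it on vectors supported on the image of [g]. *)
Lemma mulmx_colsub1 (A : pzRingType) (n k : nat) (g : 'I_k -> 'I_n)
    (y : 'cV[A]_k) (s : 'I_n) :
  s \notin codom g -> (colsub g 1%:M *m y) s 0 = 0.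
Proof.
move=> /negP sg; rewrite mxE big1 // => j _; rewrite !mxE.
by case: eqP => [sE|]; rewrite ?mul0r //; case: sg; rewrite sE codom_f.
Qed.

Lemma rowsub_colsub1 (A : pzRingType) (n k : nat) (g : 'I_k -> 'I_n) :
  injective g -> rowsub g (colsub g 1%:M) = 1%:M :> 'M[A]_k.
Proof. by move=> inj_g; apply/matrixP => i j; rewrite !mxE (inj_eq inj_g). Qed.

Lemma colsub1_rowsub (A : pzRingType) (n k : nat) (g : 'I_k -> 'I_n)
    (c : 'cV[A]_n) : injective g ->
  (forall s, s \notin codom g -> c s 0 = 0) ->
  c = colsub g 1%:M *m rowsub g c.
Proof.
move=> inj_g c0; apply/colP => s.
case: (boolP (s \in codom g)) => [/codomP[j ->]|sg]; last first.
  by rewrite mulmx_colsub1 // c0.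
have /colP/(_ j) :
    rowsub g (colsub g 1%:M *m rowsub g c) = rowsub g c.
  by rewrite -mul_rowsub_mx rowsub_colsub1 // mul1mx.
by rewrite mxE => ->; rewrite mxE.
Qed.

Section Cells.
Variables (R : realType) (X : finite_cw R).

Definition cell_image (i m : nat) (f : 'I_m -> 'I_#|cells X i|) :
  {set cw_cell X} := [set enum_val (f j) | j : 'I_m]%SET.

Lemma mem_cell_image i m (f : 'I_m -> 'I_#|cells X i|) s :
  (enum_val s \in cell_image f) = (s \in codom f).
Proof.
apply/imsetP/codomP => [[j _ /enum_val_inj ->]|[j ->]]; by exists j.
Qed.

Lemma cw_dim_enum_val i (s : 'I_#|cells X i|) : cw_dim (enum_val s) = i.
Proof. by have := enum_valP s; rewrite inE => /eqP. Qed.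

(** Indexing cells by an injection turns statements on sets of cells into statements on submatrices
    of [bd]. *)
Lemma cell_imageP i (W : {set cw_cell X}) : W \subset cells X i ->
  exists2 f : 'I_#|W| -> 'I_#|cells X i|, injective f & W = cell_image f.
Proof.
move=> sub; have inW (j : 'I_#|W|) : enum_val j \in cells X i.
  by move/fintype.subsetP: sub; apply; apply: enum_valP.
exists (fun j => enum_rank_in (inW j) (enum_val j)) => [j l|].
  move/(congr1 enum_val); rewrite !enum_rankK_in //; exact: enum_val_inj.
apply/setP => s; apply/idP/imsetP => [sW|[j _ ->]]; last first.
  by rewrite enum_rankK_in ?inW ?enum_valP.
by exists (enum_rank_in sW s); rewrite // enum_rankK_in ?inW // enum_rankK_in.
Qed.

(** [cells_below X i] contains no [i]-cell, so only the cells of the image can carry an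
    [i]-chain. *)
Lemma chains_cell_image (A : pzRingType) i m (g : 'I_m -> 'I_#|cells X i|) c :
  injective g ->
  chains A i (cells_below X i :|: cell_image g) c <->
  exists y, c = colsub g 1%:M *m y.
Proof.
move=> inj_g; split=> [chain|[y ->] s].
  exists (rowsub g c); apply: colsub1_rowsub => // s sg.
  by apply: chain; rewrite !inE cw_dim_enum_val ltnn mem_cell_image.
rewrite !inE cw_dim_enum_val ltnn mem_cell_image; exact: mulmx_colsub1.
Qed.

Lemma restrict_chain_cell_image (A : pzRingType) i m
    (f : 'I_m -> 'I_#|cells X i|) c : injective f ->
  restrict_chain A i (cell_image f) c = colsub f 1%:M *m rowsub f c.
Proof.
move=> inj_f.
have -> : rowsub f c = rowsub f (restrict_chain A i (cell_image f) c).
  by apply/colP => j; rewrite !mxE mem_cell_image codom_f.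
apply: colsub1_rowsub => // s sf.
by rewrite mxE mem_cell_image (negPf sf).
Qed.

Lemma boundaries_cell_image (A : pzRingType) d k
    (g : 'I_k -> 'I_#|cells X d.+1|) c : injective g ->
  boundaries A d (cells_below X d.+1 :|: cell_image g) c <->
  exists y, c = colsub g (bd X A d.+1) *m y.
Proof.
move=> inj_g; have bdE y : bd X A d.+1 *m (colsub g 1%:M *m y) =
    colsub g (bd X A d.+1) *m y by rewrite mulmxA mulmx_colsub mulmx1.
split=> [[_ /(chains_cell_image _ inj_g)[y ->] <-]|[y ->]].
  by exists y; rewrite bdE.
by exists (colsub g 1%:M *m y) => //; apply/chains_cell_image => //; exists y.
Qed.

Lemma map_bd (A : pzRingType) i : bd X A i = map_mx intr (bd X int i).
Proof.
by apply/matrixP => s t; rewrite !mxE; case: ifP; rewrite ?intz.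
Qed.

Lemma is_forest_cell_image d k (g : 'I_k -> 'I_#|cells X d|) : injective g ->
  is_forest d (cell_image g) <->
  forall y : 'cV[int]_k, colsub g (bd X int d) *m y = 0 -> y = 0.
Proof.
move=> inj_g; have bdE (y : 'cV_k) : bd X int d *m (colsub g 1%:M *m y) =
    colsub g (bd X int d) *m y by rewrite mulmxA mulmx_colsub mulmx1.
split=> [[_ cyc] y gy0|inj].
  have : cycles int d (cells_below X d :|: cell_image g) (colsub g 1%:M *m y).
    by split; [apply/chains_cell_image => //; exists y | rewrite bdE].
  rewrite cyc => /(congr1 (rowsub g)).
  rewrite -mul_rowsub_mx rowsub_colsub1 // mul1mx => ->.
  by apply/colP => j; rewrite !mxE.
split.
  by apply/fintype.subsetP => _ /imsetP[j _ ->]; rewrite inE cw_dim_enum_val.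
apply/seteqP; split=> [c [/(chains_cell_image _ inj_g)[y ->]]|_ ->].
  by rewrite bdE => /inj ->; rewrite mulmx0.
by split=> [s _|]; rewrite ?mxE ?mulmx0.
Qed.

(** * Forests and coforests as nonsingular submatrices of the boundary matrix *)

Section ForestCoforest.
Variables (d k : nat) (g : 'I_k -> 'I_#|cells X d.+1|).
Hypothesis inj_g : injective g.
Let M (A : pzRingType) : 'M[A]_(#|cells X d|, #|cells X d.+1|) := bd X A d.+1.

(** The forest condition makes [y] a coordinate vector for the rational boundary
    [colsub g (M rat) *m y], and in these coordinates restriction to the coforest is
    [mxsub f g (M rat)]. The size [m] is left free because it is not yet known to be [k]. *)
Lemma coforest_bij m (f : 'I_m -> 'I_#|cells X d|) : injective f ->
  is_forest d.+1 (cell_image g) ->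
  is_spanning_coforest d.+1 (cell_image g) (cell_image f) ->
  (forall y : 'cV[rat]_k, mxsub f g (M rat) *m y = 0 -> y = 0) /\
  (forall z : 'cV[rat]_m, exists y : 'cV[rat]_k, mxsub f g (M rat) *m y = z).
Proof.
move=> inj_f /(is_forest_cell_image inj_g)/rat_kernel_trivial kerM.
move=> [_ [_ /= injB surjB]].
have restrictE (y : 'cV[rat]_k) :
    restrict_chain rat d (cell_image f) (colsub g (M rat) *m y) =
    colsub f 1%:M *m (mxsub f g (M rat) *m y).
  by rewrite restrict_chain_cell_image // -mul_rowsub_mx -mxsub_comp.
have inB y : boundaries rat d (cells_below X d.+1 :|: cell_image g)
    (colsub g (M rat) *m y).
  by apply/boundaries_cell_image => //; exists y.
split=> [y Ny0|z].
  apply: kerM; rewrite map_mxsub -map_bd.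
  have := injB (colsub g (M rat) *m y) (colsub g (M rat) *m 0).
  rewrite !inE !restrictE Ny0 !mulmx0 => -> //.
  by have := inB 0; rewrite mulmx0.
have [|_ /(boundaries_cell_image _ inj_g)[y ->]] := surjB (colsub f 1%:M *m z).
  by apply/chains_cell_image => //; exists z.
rewrite restrictE => /(congr1 (rowsub f)).
rewrite -!mul_rowsub_mx !rowsub_colsub1 // !mul1mx => <-.
by exists y.
Qed.

(** The definition of a coforest does not mention its size; the isomorphism of [coforest_bij] forces
    it. *)
Lemma coforest_card (W : {set cw_cell X}) :
  is_forest d.+1 (cell_image g) ->
  is_spanning_coforest d.+1 (cell_image g) W -> #|W| = k.
Proof.
move=> forest coforest; have [f inj_f WE] := cell_imageP coforest.1.
have cf : is_spanning_coforest d.+1 (cell_image g) (cell_image f).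
  by rewrite -WE.
have [inj surj] := coforest_bij inj_f forest cf.
exact: mulmx_bij_square inj surj.
Qed.

Variable f : 'I_k -> 'I_#|cells X d|.
Hypothesis inj_f : injective f.

(** Nonsingularity over the integers is invertibility over the rationals. It makes the columns
    chosen by [g] independent, and the inverse matrix then inverts the restriction map. *)
Lemma forest_coforest_det :
  is_forest d.+1 (cell_image g) /\
  is_spanning_coforest d.+1 (cell_image g) (cell_image f) <->
  \det (mxsub f g (M int)) != 0.
Proof.
have MratE : mxsub f g (M rat) = map_mx intr (mxsub f g (M int)).
  by rewrite /M (map_bd rat); apply/matrixP => i j; rewrite !mxE.
have unitE : (mxsub f g (M rat) \in unitmx) = (\det (mxsub f g (M int)) != 0).
  by rewrite MratE unitmxE unitfE det_map_mx intr_eq0.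
rewrite -unitE; split=> [[forest coforest]|unitN].
  have [inj _] := coforest_bij inj_f forest coforest.
  rewrite -unitmx_tr -row_free_unit; apply: inj_row_free => v.
  move=> /(congr1 trmx); rewrite trmx_mul trmxK trmx0.
  by move=> /inj /(congr1 trmx); rewrite trmxK trmx0.
have restrictE (y : 'cV[rat]_k) :
    restrict_chain rat d (cell_image f) (colsub g (M rat) *m y) =
    colsub f 1%:M *m (mxsub f g (M rat) *m y).
  by rewrite restrict_chain_cell_image // -mul_rowsub_mx -mxsub_comp.
split.
  apply/is_forest_cell_image => // y /(congr1 (rowsub f)).
  rewrite -mul_rowsub_mx -mxsub_comp => Ny0.
  have detN : \det (mxsub f g (M int)) != 0 by rewrite -unitE.
  (* Over the integers the adjugate replaces the inverse: [\adj N *m N] is the scalar matrix of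
     [\det N]. *)
  have /(congr1 (mulmx (\adj (mxsub f g (M int))))) :
    mxsub f g (M int) *m y = 0.
    by rewrite Ny0; apply/colP => j; rewrite !mxE.
  rewrite mulmxA mul_adj_mx mul_scalar_mx mulmx0 => /colP Ny0'.
  apply/colP => j; rewrite mxE; apply: (mulfI detN).
  by have := Ny0' j; rewrite !mxE mulr0.
split.
  by apply/fintype.subsetP => _ /imsetP[j _ ->]; rewrite inE cw_dim_enum_val.
split=> [_ /(boundaries_cell_image _ inj_g)[y ->]||z].
- by rewrite restrictE; apply/chains_cell_image => //; eexists.
- move=> c c'; rewrite !inE => /(boundaries_cell_image _ inj_g)[y ->].
  move=> /(boundaries_cell_image _ inj_g)[y' ->].
  rewrite !restrictE => /(congr1 (rowsub f)).
  rewrite -!mul_rowsub_mx !rowsub_colsub1 // !mul1mx.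
  move=> /(congr1 (mulmx (invmx (mxsub f g (M rat))))).
  by rewrite !mulKmx // => ->.
move=> /(chains_cell_image _ inj_f)[y ->].
exists (colsub g (M rat) *m (invmx (mxsub f g (M rat)) *m y)).
  by apply/boundaries_cell_image => //; eexists.
by rewrite restrictE mulKVmx.
Qed.

(** A chain lies in the complementary subcomplex exactly when its restriction along [f] vanishes, so
    modulo such chains only the coordinates along [f] remain. *)
Lemma rel_boundaries_cell_image (c : 'cV[int]_#|cells X d|) :
  rel_boundaries int d (cells_below X d.+1 :|: cell_image g)
    (cells_below X d :|: (cells X d :\: cell_image f)) c <->
  exists y, rowsub f c = mxsub f g (M int) *m y.
Proof.
have chainsE (a : 'cV[int]_#|cells X d|) :
    chains int d (cells_below X d :|: (cells X d :\: cell_image f)) a <->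
    rowsub f a = 0.
  have inE' s :
      (enum_val s \in cells_below X d :|: (cells X d :\: cell_image f)) =
      (s \notin codom f).
    by rewrite !inE cw_dim_enum_val ltnn eqxx andbT mem_cell_image.
  split=> [a0|/colP fa0 s].
    by apply/colP => j; rewrite !mxE a0 // inE' codom_f.
  by rewrite inE' negbK => /codomP[j ->]; have := fa0 j; rewrite !mxE.
split=> [|[y cE]].
  move=> [_ /(boundaries_cell_image _ inj_g)[y ->]] [a /chainsE fa0 <-].
  exists y; rewrite raddfD /= fa0 addr0.
  by rewrite -mul_rowsub_mx -mxsub_comp.
exists (colsub g (M int) *m y).
  by apply/boundaries_cell_image => //; exists y.
exists (c - colsub g (M int) *m y); last by rewrite addrC subrK.
apply/chainsE; rewrite raddfB /= cE -mul_rowsub_mx -mxsub_comp.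
exact: subrr.
Qed.

(** The boundary of a [d]-chain lives on cells of dimension [d - 1], all of which belong to
    [cells_below X d] when [d > 0]. *)
Lemma rel_cycles_setT V W :
  rel_cycles int d (cells_below X d.+1 :|: V) (cells_below X d :|: W) = setT.
Proof.
apply/seteqP; split=> // c _; split=> s.
  by rewrite !inE cw_dim_enum_val ltnSn.
rewrite !inE cw_dim_enum_val negb_or -leqNgt => /andP[le_d _].
(* In degree 0 the index [d.-1] truncates to 0, and [bd] is the zero matrix by convention. *)
have {le_d} d0 : d = 0%N by case: (d) le_d => //= n; rewrite ltnn.
rewrite mxE big1 // => j _; rewrite !mxE cw_dim_enum_val.
case: eqP => [dE|]; rewrite ?mul0r //.
by move: (esym dE); rewrite {1}d0.
Qed.

(** Every chain is a relative cycle, and its class depends only on its restriction along [f] modulo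
    the image of [mxsub f g (M int)]; a transversal of this lattice, extended by zero, lists each
    class once. *)
Lemma forest_homology_card : \det (mxsub f g (M int)) != 0 ->
  finite_set (forest_homology d.+1 (cell_image g) (cell_image f)) /\
  #|` fset_set (forest_homology d.+1 (cell_image g) (cell_image f))| =
    `|\det (mxsub f g (M int))|%N.
Proof.
move=> /image_lattice_transversal[r [r_uniq r_size r_cover r_sep]].
set relB := rel_boundaries int d (cells_below X d.+1 :|: cell_image g)
    (cells_below X d :|: (cells X d :\: cell_image f)).
pose cl (c : 'cV[int]_#|cells X d|) := [set z | relB (z - c)].
have clP a b : cl a = cl b <->
    exists y, rowsub f a - rowsub f b = mxsub f g (M int) *m y.
  rewrite -raddfB /=; split=> [eq_cl|[y yE]].
    apply/rel_boundaries_cell_image; rewrite -/relB.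
    (* Every class contains its representative, so equality of the classes puts [a] in [cl b]. *)
    have : cl a a.
      apply/rel_boundaries_cell_image; exists 0.
      by rewrite subrr mulmx0; apply/colP => j; rewrite !mxE.
    by rewrite eq_cl.
  apply/seteqP; split=> z /rel_boundaries_cell_image[x xE];
    apply/rel_boundaries_cell_image.
    exists (x + y); rewrite mulmxDr -xE -yE -raddfD /=.
    by rewrite addrA subrK.
  exists (x - y); rewrite mulmxBr -xE -yE -raddfB /=.
  by rewrite opprB addrA subrK.
pose F := [fset x in r]%fset.
have HE : forest_homology d.+1 (cell_image g) (cell_image f) =
    (fun a => cl (colsub f 1%:M *m a)) @` [set` F].
  rewrite /forest_homology /rel_homology /= rel_cycles_setT.
  apply/seteqP; split=> [_ [c _ <-]|_ [a _ <-]]; last first.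
    by exists (colsub f 1%:M *m a).
  have [a ar [y yE]] := r_cover (rowsub f c).
  exists a; first by rewrite /= inE.
  apply/esym/clP; exists y; rewrite -yE.
  by rewrite -[in RHS](mul1mx a) -(rowsub_colsub1 _ inj_f) mul_rowsub_mx.
rewrite HE; split; first exact/finite_image/finite_fset.
rewrite fset_set_image ?set_fsetK; last exact: finite_fset.
rewrite card_in_imfset /=.
  by rewrite card_fseq undup_id.
move=> a b; rewrite !inE => ar br /clP[y yE]; apply: r_sep => //; exists y.
by move: yE; rewrite -!mul_rowsub_mx !rowsub_colsub1 // !mul1mx.
Qed.

End ForestCoforest.
End Cells.

(** * Sums over forests and coforests *)

Lemma elem_symE (F : comNzRingType) (n k : nat) (s : 'I_n -> F) :
  elem_sym k s = \sum_(h : {set 'I_n} | #|h| == k) \prod_(i in h) s i.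
Proof.
rewrite /elem_sym /mpoly.mesym.
rewrite (big_morph _ (mpoly.mevalD s) (mpoly.meval0 s)).
apply: eq_bigr => h _.
rewrite (big_morph _ (mpoly.mevalM s) (mpoly.meval1 s)).
apply: eq_bigr => i _.
exact: mpoly.mevalXU.
Qed.

(** By Vieta, [elem_sym k] is up to sign the coefficient of degree [n - k] of the product, so the
    roots need not be matched one by one. For [k > n] both sides vanish. *)
Lemma elem_sym_eq_spectrum (F : idomainType) (n k : nat) (s d : 'I_n -> F) :
  \prod_i ('X - (s i)%:P) = \prod_i ('X - (d i)%:P) ->
  elem_sym k s = elem_sym k d.
Proof.
move=> eq_sd; case: (leqP k n) => [le_kn|lt_nk]; last first.
  by rewrite /elem_sym mpoly.mesym_geqnE // !mpoly.meval0.
have elemE (u : 'I_n -> F) :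
    elem_sym k u = (-1) ^+ k * (\prod_i ('X - (u i)%:P))`_(n - k).
  have := mpoly.mroots_coeff [tuple u i | i < n]
    (Ordinal (le_kn : (k < n.+1)%N)).
  rewrite big_tuple /= => prodE.
  rewrite (eq_bigr (fun i => 'X - (tnth [tuple u i | i < n] i)%:P)) => [|i _];
    last by rewrite tnth_mktuple.
  rewrite prodE mulrA -expr2 sqrr_sign mul1r.
  by apply: mpoly.meval_eq => i; rewrite tnth_mktuple.
by rewrite !elemE eq_sd.
Qed.

(** Forests and coforests are subsets of the whole cell type, while matrix indices run over the
    cells of one dimension; [h] will be [enum_val], which links the two. *)
Lemma sum_sub_imset (S : pzSemiRingType) (T U : finType) (h : T -> U) (k : nat)
    (G : {set U} -> S) : injective h ->
  (forall V : {set U}, G V <> 0 -> {subset V <= codom h}) ->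
  k`!%:R * \sum_(V : {set U} | #|V| == k) G V =
  \sum_(f : {ffun 'I_k -> T} | injectiveb f) G [set h (f i) | i : 'I_k]%SET.
Proof.
move=> inj_h suppG; pose E (V : {set T}) := (h @: V)%SET.
rewrite (eq_bigr (fun f : {ffun 'I_k -> T} => G (E [set f i | i : 'I_k]%SET)));
  last by move=> f _; rewrite /E -imset_comp.
rewrite (sum_injective_imset _ (fun V => G (E V))); congr (_ * _).
(* A set that is not the image of its preimage leaves [codom h], so its term vanishes. *)
rewrite (bigID (fun V : {set U} => E (h @^-1: V)%SET == V)) /=.
rewrite [X in _ + X]big1 ?addr0 => [|V /andP[_ /eqP EV]]; last first.
  apply/eqP/negPn/negP => /eqP GV; apply: EV.
  apply/setP => u; apply/imsetP/idP => [[t + ->]|uV]; first by rewrite inE.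
  have /codomP[t uE] := suppG _ GV u uV.
  by exists t; rewrite // inE -uE.
rewrite (reindex_onto E (fun V => h @^-1: V)%SET) /= => [|V /andP[_ /eqP //]].
apply: eq_bigl => V; have -> : (h @^-1: E V)%SET = V.
  by apply/setP => t; rewrite inE mem_imset.
by rewrite !eqxx !andbT card_imset.
Qed.

Section ForestSum.
Variables (R : realType) (X : finite_cw R) (d k : nat).

(** The value 0 outside forest-coforest pairs allows sums over all pairs of [k]-subsets. *)
Definition forest_weight (V W : {set cw_cell X}) : nat :=
  if `[< is_forest d.+1 V /\ is_spanning_coforest d.+1 V W >]
  then (#|` fset_set (forest_homology d.+1 V W)| ^ 2)%N else 0%N.

Lemma forest_weight_cell_image (g : 'I_k -> 'I_#|cells X d.+1|)
    (f : 'I_k -> 'I_#|cells X d|) : injective g -> injective f ->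
  (forest_weight (cell_image g) (cell_image f))%:R =
  \det (mxsub f g (bd X R d.+1)) ^+ 2.
Proof.
move=> inj_g inj_f; have forestP := forest_coforest_det inj_g inj_f.
have -> : mxsub f g (bd X R d.+1) = map_mx intr (mxsub f g (bd X int d.+1)).
  by rewrite (map_bd X R); apply/matrixP => i j; rewrite !mxE.
rewrite det_map_mx /forest_weight; case: asboolP => [/forestP detN|nforest].
  have [_ ->] := forest_homology_card inj_g inj_f detN.
  by rewrite -rmorphXn -real_normK ?num_real // natrX -abszE.
have -> : \det (mxsub f g (bd X int d.+1)) = 0.
  by apply/eqP/negPn/negP => /forestP.
by rewrite expr0n.
Qed.

(** The inner sum on the left does not fix [#|W|]; [coforest_card] makes it [k] for every coforest
    that occurs. *)
Lemma sum_forest_weight :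
  (\sum_(V : {set cw_cell X} | (#|V| == k) && `[< is_forest d.+1 V >])
    \sum_(W : {set cw_cell X} | `[< is_spanning_coforest d.+1 V W >])
      #|` fset_set (forest_homology d.+1 V W)| ^ 2)%N =
  (\sum_(V : {set cw_cell X} | #|V| == k)
     \sum_(W : {set cw_cell X} | #|W| == k) forest_weight V W)%N.
Proof.
rewrite big_mkcondr /=; apply: eq_bigr => V /eqP cardV.
case: asboolP => [forest|nforest]; last first.
  rewrite big1 // => W _; rewrite /forest_weight; case: asboolP => //.
  by case=> /nforest.
rewrite big_mkcond [RHS]big_mkcond; apply: eq_bigr => W _.
rewrite /forest_weight; have [coforest|ncoforest] := asboolP; last first.
  by case: ifP => // _; case: asboolP => // -[_ /ncoforest].
have [g inj_g VE] := cell_imageP forest.1.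
move: (coforest_card inj_g); rewrite -VE cardV => cardE.
case: ifP => [_|]; last by rewrite cardE // eqxx.
by case: asboolP => // -[].
Qed.

(** The two factors [k!] count the orderings of [V] and of [W]. Non-injective indexings repeat a row
    or a column, hence give determinant 0. *)
Lemma sum_forest_weight_minors :
  k`!%:R * (k`!%:R * (\sum_(V : {set cw_cell X} | #|V| == k)
     \sum_(W : {set cw_cell X} | #|W| == k) forest_weight V W)%N%:R) =
  \sum_(f : {ffun 'I_k -> 'I_#|cells X d|})
    \sum_(g : {ffun 'I_k -> 'I_#|cells X d.+1|})
      \det (mxsub f g (bd X R d.+1)) ^+ 2 :> R.
Proof.
have cells_codom i (V : {set cw_cell X}) : V \subset cells X i ->
    {subset V <= codom (@enum_val _ [in cells X i])}.
  move=> /fintype.subsetP sub v vV; apply/codomP.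
  by exists (enum_rank_in (sub v vV) v); rewrite enum_rankK_in ?sub.
rewrite natr_sum [X in k`!%:R * X](_ : _ =
  \sum_(V : {set cw_cell X} | #|V| == k)
    k`!%:R * \sum_(W : {set cw_cell X} | #|W| == k) (forest_weight V W)%:R);
  last by rewrite mulr_sumr; apply: eq_bigr => V _; rewrite natr_sum.
rewrite (@sum_sub_imset _ _ _ (@enum_val _ [in cells X d.+1])); last 2 first.
- exact: enum_val_inj.
- move=> V Vn0; apply: cells_codom; apply/negPn/negP => nsub; apply: Vn0.
  rewrite big1 ?mulr0 // => W _; rewrite /forest_weight; case: asboolP => //.
  by case=> -[sub]; rewrite sub in nsub.
rewrite [RHS]exchange_big [LHS]big_mkcond /=; apply: eq_bigr => g _.
case: (boolP (injectiveb g)) => [/injectiveP inj_g|]; last first.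
  move=> /dinjectivePn[i _ [j /andP[]]]; rewrite inE => neq_ij _ eq_g.
  rewrite big1 // => f _; rewrite -det_tr.
  rewrite (determinant_alternate neq_ij) ?expr0n // => l.
  by rewrite !mxE eq_g.
rewrite (@sum_sub_imset _ _ _ (@enum_val _ [in cells X d])); last 2 first.
- exact: enum_val_inj.
- move=> W Wn0; apply: cells_codom; apply/negPn/negP => nsub; apply: Wn0.
  rewrite /forest_weight; case: asboolP => //.
  by case=> _ [sub]; rewrite sub in nsub.
rewrite [LHS]big_mkcond /=; apply: eq_bigr => f _.
case: (boolP (injectiveb f)) => [/injectiveP inj_f|]; last first.
  move=> /dinjectivePn[i _ [j /andP[]]]; rewrite inE => neq_ij _ eq_f.
  rewrite (determinant_alternate neq_ij) ?expr0n // => l.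
  by rewrite !mxE eq_f.
exact: forest_weight_cell_image.
Qed.

End ForestSum.

Theorem theorem8p1 (R : realType) (X : finite_cw R) (d b k : nat)
  (hd : (0 < d)%N)
  (hb : is_group_rank (boundaries int d.-1 [set: cw_cell X]%SET) b)
  (hk : (0 < k <= b)%N) :
  (forall V W : {set cw_cell X},
     is_forest d V -> #|V| = k -> is_spanning_coforest d V W ->
     finite_set (forest_homology d V W)) /\
  (exists s : 'I_#|cells X d.-1| -> R, is_spectrum (laplacian X d) s) /\
  (forall s : 'I_#|cells X d.-1| -> R, is_spectrum (laplacian X d) s ->
    elem_sym k s =
      (\sum_(V : {set cw_cell X} | (#|V| == k) && `[< is_forest d V >])
        \sum_(W : {set cw_cell X} | `[< is_spanning_coforest d V W >])
          #|` fset_set (forest_homology d V W)| ^ 2)%N%:R).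
Proof.
case: d hd hb => // d _ _.
have sym : (laplacian X d.+1)^T = laplacian X d.+1.
  by rewrite /laplacian trmx_mul trmxK.
have [e [charE minorsE]] := symmetric_spectrum sym.
split=> [V W forest cardV coforest|].
  have [g inj_g VE] := cell_imageP forest.1.
  have forest_g : is_forest d.+1 (cell_image g) by rewrite -VE.
  have cardW : #|W| = #|V|.
    by apply: (coforest_card inj_g forest_g); rewrite -VE.
  have [f inj_f WE] := cell_imageP coforest.1.
  (* Both index maps get the same domain, which makes the submatrix square. *)
  rewrite cardW in f inj_f WE.
  rewrite VE WE; apply: (forest_homology_card inj_g inj_f _).1.
  by apply/forest_coforest_det => //; rewrite -VE -WE.
split; first by exists (e 0).
move=> s /esym; rewrite charE => /elem_sym_eq_spectrum ->.
have k_neq0 : k`!%:R != 0 :> R by rewrite pnatr_eq0 -lt0n fact_gt0.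
(* There is one factor [k!] for each of [V] and [W]; on the eigenvalue side one is absorbed by
   [sum_minors_diag] and the other by Cauchy-Binet. *)
apply: (mulfI k_neq0); apply: (mulfI k_neq0).
rewrite sum_forest_weight sum_forest_weight_minors elem_symE -sum_minors_diag.
rewrite -minorsE sum_minors_mul.
apply: eq_bigr => f _; apply: eq_bigr => g _.
(* The second minor is that of the transposed submatrix, so the product is a square. *)
by rewrite -trmx_mxsub det_tr.
Qed.
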